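(* Let $S$ be a polynomial ring over a field, let $I\subset S$ be a square-free monomial ideal, and let $\Lambda$ be any subset of the variables of $S$, with the variables labeled so that $\Lambda = \{x_1,\dots,x_i\}$. Then either there exists a $j$ with $1\leq j\leq i$ such that \[ \operatorname{pd}(S/I) = \operatorname{pd}\bigl(S/((I,x_1,\dots,x_{j-1}) : x_j)\bigr), \] or \[ \operatorname{pd}(S/I) = \operatorname{pd}\bigl(S/(I,x_1,\dots,x_i)\bigr). \]
   Context: $\operatorname{pd}$ denotes projective dimension over $S$. $(I,x_1,\dots,x_{j-1})$ denotes the ideal $I+(x_1,\dots,x_{j-1})$, which for $j=1$ is just $I$. For an ideal $J$, $(J:x)=\{f\in S : xf\in J\}$. *)

(* Defs.v *)
From HB Require Import structures.
From mathcomp Require Import all_boot all_algebra.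
From mathcomp Require Import generic_quotient ring_quotient.
From mathcomp Require Import boolp.
From mathcomp Require Export mpoly.

Set Implicit Arguments.
Unset Strict Implicit.
Unset Printing Implicit Defensive.

Import GRing.Theory.
Local Open Scope ring_scope.
Local Open Scope quotient_scope.

Section QuotientModule.
Variables (R : pzRingType) (V : lmodType R) (W : submodClosed V).

(* submodClosed does not inherit from zmodClosed, which Quotient.quot requires. *)
Definition zmod_of_submod : {pred V} := fun v => v \in W.

Fact zmod_of_submod_closed : zmod_closed zmod_of_submod.
Proof. exact: GRing.submod_closedB (submodClosedP W). Qed.

HB.instance Definition _ :=
  GRing.isZmodClosed.Build V zmod_of_submod zmod_of_submod_closed.

Definition quotmod : Type := Quotient.quot zmod_of_submod.

HB.instance Definition _ := GRing.Zmodule.on quotmod.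
HB.instance Definition _ : EqQuotient V (Quotient.equiv zmod_of_submod) quotmod :=
  EqQuotient.on quotmod.
HB.instance Definition _ := @isZmodQuotient.Build V
  (Quotient.equiv zmod_of_submod) 0 -%R +%R quotmod
  (lock _) (@Quotient.pi_opp _ zmod_of_submod)
  (@Quotient.pi_add _ zmod_of_submod).

Definition quotmod_scale (a : R) : quotmod -> quotmod :=
  lift_op1 quotmod ( *:%R a).

Fact pi_quotmod_scale a :
  {morph \pi_quotmod : v / a *: v >-> quotmod_scale a v}.
Proof.
move=> v; rewrite /quotmod_scale; unlock; apply/eqP.
have vW : v - repr (\pi_quotmod v) \in zmod_of_submod.
  by rewrite Quotient.idealrBE; apply/eqP; rewrite reprK.
by rewrite -Quotient.idealrBE -scalerBr; apply: (rpredZ (s := W)).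
Qed.

Canonical pi_quotmod_scale_morph a := PiMorph1 (pi_quotmod_scale a).

Fact quotmod_scalerA a b v :
  quotmod_scale a (quotmod_scale b v) = quotmod_scale (a * b) v.
Proof. by rewrite -[v]reprK -!pi_quotmod_scale scalerA. Qed.

Fact quotmod_scale1r : left_id 1 quotmod_scale.
Proof. by move=> v; rewrite -[v]reprK -pi_quotmod_scale scale1r. Qed.

Fact quotmod_scalerDr : right_distributive quotmod_scale +%R.
Proof.
move=> a u v; rewrite -[u]reprK -[v]reprK -raddfD -!pi_quotmod_scale.
by rewrite scalerDr raddfD.
Qed.

Fact quotmod_scalerDl v : {morph quotmod_scale^~ v : a b / a + b}.
Proof.
by move=> a b; rewrite -[v]reprK -!pi_quotmod_scale scalerDl raddfD.
Qed.

HB.instance Definition _ := GRing.Zmodule_isLmodule.Build R quotmod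
  quotmod_scalerA quotmod_scale1r quotmod_scalerDr quotmod_scalerDl.

Fact pi_quotmod_is_scalable : scalable (\pi_quotmod : V -> quotmod).
Proof. by move=> a v; rewrite pi_quotmod_scale. Qed.

HB.instance Definition _ := GRing.isScalable.Build R V quotmod *:%R
  (\pi_quotmod : V -> quotmod) pi_quotmod_is_scalable.

End QuotientModule.

Section ProjectiveDimension.
Variable R : pzRingType.
Implicit Types M : lmodType R.

Definition projective (P : lmodType R) : Prop :=
  forall (M N : lmodType R) (g : {linear M -> N}) (f : {linear P -> N}),
    (forall y, exists x, g x = y) ->
    exists h : {linear P -> M}, forall p, g (h p) = f p.

(* There is an exact sequence 0 -> P d -> ... -> P 0 -> M -> 0 with every P i
   projective; it is padded with zero modules in degrees above d. *)
Definition has_projective_resolution M (d : nat) : Prop :=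
  exists (P : nat -> lmodType R)
         (del : forall i, {linear P i.+1 -> P i}) (eps : {linear P 0 -> M}),
    [/\ forall i, projective (P i),
        forall m, exists p, eps p = m,
        forall p, eps p = 0 <-> exists q, del 0 q = p,
        forall i p, del i p = 0 <-> exists q, del i.+1 q = p
      & forall i, (d < i)%N -> forall p : P i, p = 0].

(* None stands for infinite projective dimension; the zero module has
   projective dimension 0. *)
Definition pd M : option nat :=
  match pselect (exists d, `[< has_projective_resolution M d >]) with
  | left ex_d => Some (ex_minn ex_d)
  | right _ => None
  end.

End ProjectiveDimension.

Section Ideals.
Variable R : comNzRingType.

(* Not idealr, which excludes the unit ideal; a colon ideal may be the whole
   ring. *)
Definition ideal := submodClosed R^o.

Definition idgen_pred (A : R -> Prop) : {pred R^o} := fun f =>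
  `[< exists (m : nat) (a g : 'I_m -> R),
        (forall i, A (g i)) /\ f = \sum_(i < m) a i * g i >].

Fact idgen_closed (A : R -> Prop) :
  GRing.subsemimod_closed (idgen_pred A).
Proof.
split; [split|].
- apply/asboolP; exists 0%N, (fun=> 0), (fun=> 0).
  by split=> [[]|]; rewrite ?big_ord0.
- move=> _ _ /asboolP[m [a [g [Ag ->]]]] /asboolP[l [b [h [Ah ->]]]].
  apply/asboolP; exists (m + l)%N,
    (fun i => match split i with inl j => a j | inr j => b j end),
    (fun i => match split i with inl j => g j | inr j => h j end).
  split=> [i|]; first by case: (split i).
  rewrite big_split_ord /=; congr (_ + _); apply: eq_bigr => i _.
    by rewrite -[lshift l i]/(unsplit (inl i)) unsplitK.
  by rewrite -[rshift m i]/(unsplit (inr i)) unsplitK.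
- move=> c _ /asboolP[m [a [g [Ag ->]]]].
  apply/asboolP; exists m, (fun i => c * a i), g; split=> //.
  by rewrite scaler_sumr; apply: eq_bigr => i _; rewrite -mulrA.
Qed.

HB.instance Definition _ A :=
  GRing.isSubmodClosed.Build R R^o (idgen_pred A) (idgen_closed A).

Definition idgen (A : R -> Prop) : ideal := idgen_pred A.

Definition adjoin (I : ideal) (s : seq R) : ideal :=
  idgen (fun f => f \in I \/ f \in s).

Definition colon_pred (I : ideal) (x : R) : {pred R^o} :=
  fun f => (x * f : R^o) \in I.

Fact colon_closed I x : GRing.subsemimod_closed (colon_pred I x).
Proof.
split; [split|].
- by rewrite unfold_in /colon_pred mulr0 rpred0.
- move=> f g; rewrite !unfold_in /colon_pred => If Ig.
  by rewrite mulrDr; exact: (@rpredD _ I).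
- move=> a f; rewrite !unfold_in /colon_pred => If.
  by rewrite -[a *: f]/(a * f) mulrCA; apply: (rpredZ (s := I)).
Qed.

HB.instance Definition _ I x :=
  GRing.isSubmodClosed.Build R R^o (colon_pred I x) (colon_closed I x).

Definition colon (I : ideal) (x : R) : ideal := colon_pred I x.

End Ideals.

Definition squarefree_monomial_ideal (k : fieldType) (n : nat)
    (I : ideal {mpoly k[n]}) : Prop :=
  exists2 G : 'X_{1..n} -> Prop,
    forall m, G m -> forall v : 'I_n, (m v <= 1)%N
  & I =i idgen (fun f => exists2 m, G m & f = 'X_[m]).

(* Main.v *)
(* For one variable t, the sequence 0 -> S/(I:t) -> S/I -> S/(I,t) -> 0 is exact,
   and for any short exact sequence 0 -> A -> B -> C -> 0 the inequality
   pd A <= pd B forces pd B = pd A or pd B = pd C.  Adjoining the variables one at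
   a time keeps the ideal square-free and monomial, so everything reduces to
   pd S/(I:t) <= pd S/I.

   Let sigma : S -> S substitute 1 for t.  As I is monomial, t - 1 is regular on
   S/I, so extension of scalars along sigma, which is reduction modulo t - 1
   followed by the flat extension adjoining t, maps a projective resolution of S/I
   to one of S (x)_sigma S/I; as I is square-free, this module is S/(I:t).
   Extension of scalars is handled without tensor products: it is characterised by
   a direct sum decomposition, from which follows the adjunction with restriction
   of scalars along sigma, and it is only ever constructed for free modules and for
   S/I. *)
From HB Require Import structures.
From mathcomp Require Import all_boot all_algebra.
From mathcomp Require Import boolp freeg.
Require Import Defs.

Set Implicit Arguments.
Unset Strict Implicit.
Unset Printing Implicit Defensive.

Import GRing.Theory.
Local Open Scope ring_scope.

(** * Projective dimension and short exact sequences *)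

Section Modules.
Variable R : pzRingType.

(** Packs a function into a linear map in the middle of a proof, where the function is often the
    outcome of a choice; only its pointwise values are kept. *)
Lemma linear_of (A B : lmodType R) (f : A -> B) :
  (forall a u v, f (a *: u + v) = a *: f u + f v) ->
  exists g : {linear A -> B}, g =1 f.
Proof.
move=> Hf.
pose l := GRing.isLinear.Build R A B *:%R f Hf.
pose g : {linear A -> B} := HB.pack f l.
by exists g.
Qed.

Section Kernel.
Variables (A B : lmodType R) (f : {linear A -> B}).

Definition ker_pred : {pred A} := fun a => f a == 0.

Fact ker_closed : GRing.subsemimod_closed ker_pred.
Proof.
have kerE a : (a \in ker_pred) = (f a == 0) by [].
split; [split|] => [|u v|a u]; rewrite !kerE.
- by rewrite linear0.
- by move=> /eqP fu /eqP fv; rewrite linearD fu fv addr0.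
- by move=> /eqP fu; rewrite linearZ_LR fu scaler0.
Qed.

HB.instance Definition _ := GRing.isSubmodClosed.Build R A ker_pred ker_closed.

Definition kernel : Type := {a : A | a \in ker_pred}.

HB.instance Definition _ := SubChoice.on kernel.
HB.instance Definition _ := [SubChoice_isSubLmodule of kernel by <:].

End Kernel.

Definition exact_pair (A B C : lmodType R) (i : A -> B) (p : B -> C) :=
  forall b, p b = 0 <-> exists a, i a = b.

Definition ses (A B C : lmodType R) (i : {linear A -> B}) (p : {linear B -> C}) :=
  [/\ injective i, forall c, exists b, p b = c & exact_pair i p].

Lemma kernel_exists (A B : lmodType R) (f : {linear A -> B}) :
  exists (K : lmodType R) (i : {linear K -> A}), injective i /\ exact_pair i f.
Proof.
exists (kernel f), (val : {linear kernel f -> A}); split; first exact: val_inj.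
move=> a; split=> [fa | [[u Hu] <-]]; last exact/eqP.
have Ha : a \in ker_pred f by apply/eqP.
by exists (Sub a Ha).
Qed.

(** Injectivity of [i] makes the chosen preimages unique, hence linear in [x]. *)
Lemma lift_to_kernel (K A X : lmodType R) (i : {linear K -> A})
    (g : {linear X -> A}) :
  injective i -> (forall x, exists k, i k = g x) ->
  exists g' : {linear X -> K}, forall x, i (g' x) = g x.
Proof.
move=> inj_i /choice[h Hh].
have [a u v|g' Hg'] := @linear_of X K h; last by exists g' => x; rewrite Hg'.
by apply: inj_i; rewrite linearP !Hh linearP.
Qed.

Lemma projective_iso (M N : lmodType R) (f : {linear M -> N}) :
  injective f -> (forall n, exists m, f m = n) -> projective M -> projective N.
Proof.
move=> inj_f surj_f projM X Y g h surj_g.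
have [f' f'K] := @lift_to_kernel M N N f idfun inj_f surj_f.
have [l Hl] := projM X Y g (h \o f) surj_g.
by exists (l \o f') => n /=; rewrite Hl /= f'K.
Qed.

(** A section [s] splits [p], and [b - s (p b)] retracts [B] onto [A]; lifts on the two summands add
    up to a lift on [B]. *)
Lemma projective_ext (A B C : lmodType R) (i : {linear A -> B})
    (p : {linear B -> C}) :
  ses i p -> projective A -> projective C -> projective B.
Proof.
move=> [inj_i surj_p ex] projA projC X Y g f surj_g.
have [s Hs] := projC B C p idfun surj_p.
have [r Hr] : exists r : {linear B -> A}, forall b, i (r b) = b - s (p b).
  have [a u v|k Hk] := @linear_of B B (fun b => b - s (p b)).
    by rewrite !linearP scalerDr addrACA.
  have [b|r Hr] := @lift_to_kernel A B B i k inj_i.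
    by apply/ex; rewrite Hk linearB Hs subrr.
  by exists r => b; rewrite Hr Hk.
have [h1 Hh1] := projA X Y g (f \o i) surj_g.
have [h2 Hh2] := projC X Y g (f \o s) surj_g.
have [a u v|h Hh] := @linear_of B X (fun b => h1 (r b) + h2 (p b)).
  by rewrite !linearP scalerDr addrACA.
exists h => b.
by rewrite Hh linearD Hh1 Hh2 /= Hr -linearD subrK.
Qed.

Lemma projective_sub (A B P : lmodType R) (i : {linear A -> B})
    (p : {linear B -> P}) :
  ses i p -> projective P -> projective B -> projective A.
Proof.
move=> [inj_i surj_p ex] projP projB X Y g f surj_g.
have [s Hs] := projP B P p idfun surj_p.
have [a u v|k Hk] := @linear_of B B (fun b => b - s (p b)).
  by rewrite !linearP scalerDr addrACA.
have [b|r Hr] := @lift_to_kernel A B B i k inj_i.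
  by apply/ex; rewrite Hk linearB Hs subrr.
have [h Hh] := projB X Y g (f \o r) surj_g.
exists (h \o i) => a; rewrite /= Hh /=; congr (f _).
apply: inj_i; rewrite Hr Hk.
by have /ex-> : exists a', i a' = i a; [exists a | rewrite linear0 subr0].
Qed.

Lemma projective0 : projective 'rV[R]_0.
Proof.
move=> X Y g f surj_g.
have [a u v|h Hh] := @linear_of 'rV[R]_0 X (fun=> 0).
  by rewrite scaler0 addr0.
by exists h => p; rewrite Hh (thinmx0 p) !linear0.
Qed.

(** The bound pd <= d in a form suited to induction: one projective is stripped off and the bound
    passes to the syzygy. [resolution_pdle] and [pdle_resolution] identify it with the existence of
    a resolution. *)
Fixpoint pdle d (M : lmodType R) : Prop :=
  if d is d'.+1 then
    exists (P K : lmodType R) (i : {linear K -> P}) (p : {linear P -> M}),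
      [/\ projective P, ses i p & pdle d' K]
  else projective M.

Lemma pdle_iso d (M N : lmodType R) (f : {linear M -> N}) :
  injective f -> (forall n, exists m, f m = n) -> pdle d M -> pdle d N.
Proof.
case: d => [|d] inj_f surj_f; first exact: projective_iso inj_f surj_f.
case=> [P [K [i [p [projP [inj_i surj_p ex] Kd]]]]].
exists P, K, i, (f \o p); split=> //; split=> // [n|q].
  by have [m <-] := surj_f n; have [q <-] := surj_p m; exists q.
by rewrite -ex /=; split=> [fpq|->]; [apply: inj_f|]; rewrite ?fpq linear0.
Qed.

Lemma pdle_projective d (M : lmodType R) : projective M -> pdle d M.
Proof.
elim: d M => // d IHd M projM.
exists M, 'rV[R]_0, \0, idfun; split=> //; last exact/IHd/projective0.
split=> [u v _|m|m]; first by rewrite [u]thinmx0 [v]thinmx0.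
  by exists m.
by split=> [/= ->|[_ <-]] //; exists 0.
Qed.

Lemma pdleS d (M : lmodType R) : pdle d M -> pdle d.+1 M.
Proof.
elim: d M => [|d IHd] M; first exact: pdle_projective.
by case=> [P [K [i [p [projP ip /IHd Kd]]]]]; exists P, K, i, p.
Qed.

Lemma pdleW d e (M : lmodType R) : (d <= e)%N -> pdle d M -> pdle e M.
Proof.
move=> /subnKC <- Md.
by elim: (e - d)%N => [|m]; rewrite ?addn0 ?addnS //; exact: pdleS.
Qed.

Lemma ses_pair (A B : lmodType R) :
  exists (i : {linear A -> (A * B)%type}) (p : {linear (A * B)%type -> B}),
    [/\ i =1 (fun a => (a, 0)), p =1 snd & ses i p].
Proof.
have [a u v|i Hi] := @linear_of A (A * B)%type (fun a => (a, 0)).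
  by congr pair; rewrite /= scaler0 addr0.
have [//|p Hp] := @linear_of (A * B)%type B snd.
exists i, p; split=> //; split=> [u v|b|[u v]].
- by rewrite !Hi => -[].
- by exists (0, b); rewrite Hp.
- rewrite Hp /=; split=> [->|[w]]; first by exists u; rewrite Hi.
  by rewrite Hi => -[].
Qed.

Lemma projective_pair (A B : lmodType R) :
  projective A -> projective B -> projective (A * B)%type.
Proof.
by have [i [p [_ _ ip]]] := ses_pair A B; apply: projective_ext ip.
Qed.

(** Horseshoe lemma: [B] is covered by [PA * PC], and the kernels of the three covers form a short
    exact sequence to which the induction applies. *)
Lemma pdle_ext d (A B C : lmodType R) (i : {linear A -> B})
    (p : {linear B -> C}) :
  ses i p -> pdle d A -> pdle d C -> pdle d B.
Proof.
elim: d A B C i p => [|d IHd] A B C i p; first exact: projective_ext.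
move=> [inj_i surj_p ex].
move=> [PA [KA [iA [pA [projPA [iA_inj pA_surj exA] KAd]]]]].
move=> [PC [KC [iC [pC [projPC [iC_inj pC_surj exC] KCd]]]]].
have [l Hl] := projPC B C p pC surj_p.
have pi0 a : p (i a) = 0 by apply/ex; exists a.
have [a u v|q Hq] := @linear_of (PA * PC)%type B (fun u => i (pA u.1) + l u.2).
  by rewrite /= !linearP scalerDr addrACA.
have [K [j [inj_j exj]]] := kernel_exists q.
have [a u v|a' Ha'] := @linear_of KA (PA * PC)%type (fun k => (iA k, 0)).
  by rewrite linearP; congr pair; rewrite /= scaler0 addr0.
have [k|a Ha] := @lift_to_kernel K (PA * PC)%type KA j a' inj_j.
  apply/exj; rewrite Hq Ha' /= linear0 addr0.
  by have /exA-> : exists k', iA k' = iA k; [exists k | rewrite linear0].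
have [//|b' Hb'] := @linear_of (PA * PC)%type PC snd.
have [k|b Hb] := @lift_to_kernel KC PC K iC (b' \o j) iC_inj.
  apply/exC; rewrite -Hl /= Hb'.
  have : p (q (j k)) = 0.
    by have /exj-> : exists k', j k' = j k; [exists k | rewrite linear0].
  by rewrite Hq linearD pi0 add0r.
have ses_ab : ses a b.
  split=> [u v uv|k|k].
  - apply: iA_inj; have := congr1 j uv; rewrite !Ha !Ha' => e.
    exact: (congr1 fst e).
  (* The element [l (iC k)] comes from [A]; a preimage [u] of it in [PA] corrects the pair to
     [(- u, iC k)], which lies in [K]. *)
  - have /ex[a1] : p (l (iC k)) = 0 by rewrite Hl; apply/exC; exists k.
    have [u <-] := pA_surj a1 => e.
    have /exj[k' Hk'] : q (- u, iC k) = 0 by rewrite Hq /= !linearN -e addNr.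
    by exists k'; apply: iC_inj; rewrite Hb /= Hb' Hk'.
  - split=> [bk|[k' <-]]; last first.
      by apply: iC_inj; rewrite Hb /= Hb' Ha Ha' linear0.
    have jk2 : (j k).2 = 0 by rewrite -Hb' -[LHS]/((b' \o j) k) -Hb bk linear0.
    have : q (j k) = 0 by apply/exj; exists k.
    rewrite Hq jk2 linear0 addr0 -(linear0 i) => /inj_i/exA[k' Hk'].
    exists k'; apply: inj_j; rewrite Ha Ha' Hk' -jk2.
    by case: (j k).
exists (PA * PC)%type, K, j, q; split; first exact: projective_pair.
  split=> // b0.
  have [v Hv] := pC_surj (p b0).
  have /ex[a1] : p (b0 - l v) = 0 by rewrite linearB Hl Hv subrr.
  have [u <-] := pA_surj a1 => e.
  by exists (u, v); rewrite Hq /= e subrK.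
exact: IHd ses_ab KAd KCd.
Qed.

(** [G] is the preimage of [A] in [P]: it is the kernel of [P -> C], and it covers [A] with the same
    kernel [K] as [P -> B]. *)
Lemma ses_preimage (K P A B C : lmodType R) (iB : {linear K -> P})
    (pB : {linear P -> B}) (i : {linear A -> B}) (p : {linear B -> C}) :
  ses iB pB -> ses i p ->
  exists (G : lmodType R) (j : {linear G -> P}) (a : {linear K -> G})
    (b : {linear G -> A}), ses j (p \o pB) /\ ses a b.
Proof.
move=> [iB_inj pB_surj exB] [inj_i surj_p ex].
have [G [j [inj_j exj]]] := kernel_exists (p \o pB).
have [k|a Ha] := @lift_to_kernel G P K j iB inj_j.
  apply/exj => /=.
  by have /exB-> : exists k', iB k' = iB k; [exists k | rewrite linear0].
have [k|b Hb] := @lift_to_kernel A B G i (pB \o j) inj_i.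
  by apply/ex/exj; exists k.
exists G, j, a, b; split; first split=> // c.
  by have [b1 <-] := surj_p c; have [u <-] := pB_surj b1; exists u.
split=> [u v uv|a1|k].
- by apply: iB_inj; rewrite -!Ha uv.
- have [u Hu] := pB_surj (i a1).
  have /exj[k Hk] : (p \o pB) u = 0 by rewrite /= Hu; apply/ex; exists a1.
  by exists k; apply: inj_i; rewrite Hb /= Hk.
- split=> [bk|[k' <-]].
    have /exB[k' Hk'] : pB (j k) = 0.
      by rewrite -[LHS]/((pB \o j) k) -Hb bk linear0.
    by exists k'; apply: inj_j; rewrite Ha.
  apply: inj_i; rewrite Hb /= Ha linear0.
  by apply/exB; exists k'.
Qed.

(** The kernel [G] of [P -> B -> C] is a first syzygy of [C] and an extension of [A] by [K], both
    bounded by [d]. *)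
Lemma pdle_quotient d (A B C : lmodType R) (i : {linear A -> B})
    (p : {linear B -> C}) :
  ses i p -> pdle d A -> pdle d.+1 B -> pdle d.+1 C.
Proof.
move=> ip Ad [P [K [iB [pB [projP sesB Kd]]]]].
have [G [j [a [b [sesj ab]]]]] := ses_preimage sesB ip.
by exists P, G, j, (p \o pB); split=> //; apply: pdle_ext ab _ _.
Qed.

(* If [B] is covered by a projective [P], then [A] is covered by the preimage of
   [A] in [P], which is projective as the kernel of a map onto [Q], and both
   covers have the same kernel. *)
Lemma pdle_sub d (A B Q : lmodType R) (i : {linear A -> B})
    (p : {linear B -> Q}) :
  ses i p -> projective Q -> pdle d B -> pdle d A.
Proof.
case: d => [|d] ip projQ; first exact: projective_sub ip projQ.
move=> [P [K [iB [pB [projP sesB Kd]]]]].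
have [G [j [a [b [sesj ab]]]]] := ses_preimage sesB ip.
by exists G, K, a, b; split=> //; apply: projective_sub sesj _ _.
Qed.

(** * Fiber products and Schanuel's lemma *)

Definition fiber_product (P Q M X : lmodType R) (p : P -> M) (q : Q -> M)
    (x1 : X -> P) (x2 : X -> Q) :=
  (forall u v, p u = q v <-> exists x, x1 x = u /\ x2 x = v) /\
  (forall x y, x1 x = x1 y -> x2 x = x2 y -> x = y).

Lemma fiber_productC (P Q M X : lmodType R) (p : P -> M) (q : Q -> M)
    (x1 : X -> P) (x2 : X -> Q) :
  fiber_product p q x1 x2 -> fiber_product q p x2 x1.
Proof.
move=> [ex inj]; split=> [u v|x y e2 e1]; last exact: inj.
split=> [/esym/ex[x [? ?]]|[x [? ?]]]; first by exists x.
by apply/esym/ex; exists x.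
Qed.

Lemma fiber_product_exists (P Q M : lmodType R) (p : {linear P -> M})
    (q : {linear Q -> M}) :
  exists (X : lmodType R) (x1 : {linear X -> P}) (x2 : {linear X -> Q}),
    fiber_product p q x1 x2.
Proof.
have [a u v|f Hf] := @linear_of (P * Q)%type M (fun u => p u.1 - q u.2).
  by rewrite /= !linearP scalerDr addrACA.
have [X [j [inj_j exj]]] := kernel_exists f.
have [//|f1 Hf1] := @linear_of (P * Q)%type P fst.
have [//|f2 Hf2] := @linear_of (P * Q)%type Q snd.
exists X, (f1 \o j), (f2 \o j); split=> [u v|x y /=].
  split=> [puv|[x /= [<- <-]]].
    have /exj[x Hx] : f (u, v) = 0 by rewrite Hf /= puv subrr.
    by exists x; rewrite /= Hf1 Hf2 Hx.
  apply/eqP; rewrite -subr_eq0 Hf1 Hf2 -Hf; apply/eqP/exj; by exists x.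
rewrite !Hf1 !Hf2 => e1 e2; apply: inj_j.
by move: e1 e2; case: (j x) (j y) => [u v] [u' v'] /= -> ->.
Qed.

Lemma fiber_product_ses (K P Q M X : lmodType R) (i : {linear K -> P})
    (p : {linear P -> M}) (q : {linear Q -> M}) (x1 : {linear X -> P})
    (x2 : {linear X -> Q}) :
  ses i p -> fiber_product p q x1 x2 -> exists a : {linear K -> X}, ses a x2.
Proof.
move=> [inj_i surj_p ex] [exx injx].
have /choice[h Hh] k : exists x, x1 x = i k /\ x2 x = 0.
  by apply/exx; rewrite linear0; apply/ex; exists k.
have h1 k : x1 (h k) = i k by case: (Hh k).
have h2 k : x2 (h k) = 0 by case: (Hh k).
have [c u v|a Ha] := @linear_of K X h.
  apply: injx; first by rewrite linearP !h1 linearP.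
  by rewrite linearP !h2 scaler0 addr0.
exists a; split=> [u v uv|v|x].
- by apply: inj_i; rewrite -!h1 -!Ha uv.
- have [u Hu] := surj_p (q v).
  by have [x [_ Hx]] := (exx u v).1 Hu; exists x.
- split=> [x20|[k <-]]; last by rewrite Ha h2.
  have : p (x1 x) = q (x2 x) by apply/exx; exists x.
  rewrite x20 linear0 => /ex[k Hk]; exists k.
  by apply: injx; rewrite Ha ?h1 ?h2.
Qed.

(** The fiber product [X] of the two covers maps onto [Q] with kernel [K] and onto [P] with kernel
    [K'], so the bound goes from [K] up to [X] and from there down to [K']. *)
Lemma schanuel d (K P K' Q M : lmodType R) (i : {linear K -> P})
    (p : {linear P -> M}) (i' : {linear K' -> Q}) (q : {linear Q -> M}) :
  ses i p -> ses i' q -> projective P -> projective Q -> pdle d K -> pdle d K'.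
Proof.
move=> ip iq projP projQ Kd.
have [X [x1 [x2 fX]]] := fiber_product_exists p q.
have [a ax] := fiber_product_ses ip fX.
have [b bx] := fiber_product_ses iq (fiber_productC fX).
exact: pdle_sub bx projP (pdle_ext ax Kd (pdle_projective d projQ)).
Qed.

Lemma resolution_pdle d (M : lmodType R) :
  has_projective_resolution M d -> pdle d M.
Proof.
elim: d M => [|d IHd] M [P [del [eps [projP surj ex0 exS big]]]].
  apply: (projective_iso (f := eps)) => // u v uv.
  apply/eqP; rewrite -subr_eq0; apply/eqP.
  have /ex0[w <-] : eps (u - v) = 0 by rewrite linearB uv subrr.
  by rewrite (big 1%N _ w) // linear0.
have [K [i [inj_i exi]]] := kernel_exists eps.
have [w|e He] := @lift_to_kernel K (P 0%N) (P 1%N) i (del 0%N) inj_i.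
  by apply/exi/ex0; exists w.
exists (P 0%N), K, i, eps; split=> //; apply: IHd.
exists (fun n => P n.+1), (fun n => del n.+1), e; split=> // [k|u|n dn u].
- have /ex0[w Hw] : eps (i k) = 0 by apply/exi; exists k.
  by exists w; apply: inj_i; rewrite He.
- rewrite -exS; split=> [eu|du]; first by rewrite -He eu linear0.
  by apply: inj_i; rewrite He linear0.
- exact: big.
Qed.

Lemma pdle_resolution d (M : lmodType R) :
  pdle d M -> has_projective_resolution M d.
Proof.
elim: d M => [|d IHd] M.
  move=> projM; pose P n : lmodType R := if n is 0%N then M else 'rV[R]_0.
  exists P, (fun n => \0), idfun.
  have P0 n (u : P n.+1) : u = 0 by rewrite [u]thinmx0.
  split=> [[|n] //|m|u|n u|[] //].
  - exact: projective0.
  - by exists m.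
  - by split=> [/= ->|[_ <-]] //; exists 0.
  - by split=> // _; exists 0; rewrite linear0 (P0 n u).
move=> [P0 [K [i [p [projP [inj_i surj_p ex] /IHd]]]]].
move=> [P [del [eps [projP' surj ex0 exS big]]]].
pose P' n : lmodType R := if n is n'.+1 then P n' else P0.
pose del' n : {linear P' n.+1 -> P' n} :=
  if n is n'.+1 return {linear P' n.+1 -> P' n} then del n' else i \o eps.
exists P', del', p; split=> // [[]//|u|[|n] u|[|n] // dn u].
- rewrite ex; split=> [[k <-]|[w <-]]; last by exists (eps w).
  by have [w <-] := surj k; exists w.
- by rewrite -ex0 /=; split=> [|->]; rewrite ?linear0 // -(linear0 i) => /inj_i.
- exact: exS.
- exact: big.
Qed.

Lemma pd_eq (M N : lmodType R) :
  (forall d, pdle d M <-> pdle d N) -> pd M = pd N.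
Proof.
move=> MN.
(* [pd] depends on the module only through the predicate that it minimises, so equality of the
   predicates suffices and no minima are compared. *)
pose least (Q : pred nat) := match pselect (exists d, Q d) with
  | left ex_d => Some (ex_minn ex_d) | right _ => None end.
rewrite -[LHS]/(least (fun d => `[< has_projective_resolution M d >])).
rewrite -[RHS]/(least (fun d => `[< has_projective_resolution N d >])).
congr least; apply/funext => d; apply/asbool_equiv_eq.
by split=> /resolution_pdle/MN/pdle_resolution.
Qed.

Lemma pd_ses (A B C : lmodType R) (i : {linear A -> B}) (p : {linear B -> C}) :
  ses i p -> (forall d, pdle d B -> pdle d A) -> pd B = pd A \/ pd B = pd C.
Proof.
move=> ip BA.
have [AB|] := pselect (forall d, pdle d A -> pdle d B).
  by left; apply: pd_eq => d; split; [exact: BA | exact: AB].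
(* Here [pd A <= d < pd B], so that [B] and [C] fail the bound [e] for [e <= d],
   while [A] satisfies [e.-1] for [e > d]. *)
move=> /existsNP[d /not_implyP[Ad nBd]]; right; apply: pd_eq => e.
have [ed|de] := leqP e d.
  split=> [/(pdleW ed)//|/(pdleW ed) Cd].
  by case: nBd; apply: pdle_ext ip Ad Cd.
split=> [|Ce]; last exact: pdle_ext ip (pdleW (ltnW de) Ad) Ce.
by case: e de => // e de; apply: pdle_quotient ip _; apply: pdleW Ad.
Qed.

(** A linear map given by its graph: for a relation closed under the module operations, being
    single-valued only has to be checked at 0. *)
Lemma linear_of_rel (N A : lmodType R) (rel : N -> A -> Prop) :
  (forall n y n' y', rel n y -> rel n' y' -> rel (n + n') (y + y')) ->
  (forall a n y, rel n y -> rel (a *: n) (a *: y)) ->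
  (forall n, exists y, rel n y) -> (forall y, rel 0 y -> y = 0) ->
  exists k : {linear N -> A}, forall n, rel n (k n).
Proof.
move=> relD relZ /choice[h Hh] rel0.
have [a u v|k Hk] := @linear_of N A h; last by exists k => n; rewrite Hk.
apply/eqP; rewrite -subr_eq0; apply/eqP/rel0.
have rel1 : rel (a *: u + v) (a *: h u + h v) by apply: relD => //; apply: relZ.
have := relD _ _ _ _ (Hh (a *: u + v)) (relZ (-1) _ _ rel1).
by rewrite !scaleN1r subrr.
Qed.

Lemma linear_factor (V Q X : lmodType R) (p : {linear V -> Q})
    (g : {linear V -> X}) :
  (forall q, exists v, p v = q) -> (forall v, p v = 0 -> g v = 0) ->
  exists g' : {linear Q -> X}, forall v, g' (p v) = g v.
Proof.
move=> surj_p p0.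
have [n y n' y' [u [<- <-]] [v [<- <-]]|a n y [u [<- <-]]|n|y [u [/p0 gu <-]]//|g' Hg'] :=
  @linear_of_rel Q X (fun q y => exists v, p v = q /\ g v = y).
- by exists (u + v); rewrite !linearD.
- by exists (a *: u); rewrite !linearZ_LR.
- by have [v Hv] := surj_p n; exists (g v), v.
exists g' => v; have [u [Hu <-]] := Hg' (p v).
by apply/eqP; rewrite -subr_eq0 -linearB p0 // linearB Hu subrr.
Qed.

(** The interface through which quotients are used from here on: a surjection with known kernel. *)
Lemma quotmod_proj (V : lmodType R) (W : submodClosed V) :
  exists p : {linear V -> quotmod W},
    (forall q, exists v, p v = q) /\ forall v, p v = 0 <-> v \in W.
Proof.
exists (\pi_(quotmod W)%qT : {linear V -> quotmod W}); split=> [q|v].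
  by exists (repr q); rewrite /= reprK.
rewrite -(linear0 (\pi_(quotmod W)%qT : {linear V -> quotmod W})) /=.
split=> [/eqP|vW]; last apply/eqP; by rewrite -Quotient.idealrBE subr0.
Qed.

End Modules.

(** * Free modules *)

Section FreeModule.
Variables (R : nzRingType) (X : choiceType).

Lemma fgliftE (M : lmodType R) (f : X -> M) (D : {freeg X / R}) :
  fglift f D = \sum_(z <- dom D) coeff z D *: f z.
Proof.
pose l : {additive {freeg X / R} -> M} := HB.pack (fglift f)
  (GRing.isAdditive.Build _ _ (fglift f) (lift_is_additive f)).
rewrite -{1}[D]freeg_sumE -[LHS]/(l _) raddf_sum.
by apply: eq_bigr => z _; rewrite /= liftU.
Qed.

Lemma fglift_linear (M : lmodType R) (f : X -> M) :
  exists p : {linear {freeg X / R} -> M}, p =1 fglift f.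
Proof.
apply: linear_of => a u v.
pose l : {additive {freeg X / R} -> M} := HB.pack (fglift f)
  (GRing.isAdditive.Build _ _ (fglift f) (lift_is_additive f)).
rewrite -![fglift f _]/(l _) raddfD; congr (_ + _).
rewrite -[a *: u]/(fgscale a u) /fgscale raddf_sum -[l u]/(fglift f u).
rewrite fgliftE scaler_sumr.
by apply: eq_bigr => z _; rewrite /= liftU scalerA.
Qed.

Lemma freeg_projective : projective {freeg X / R}.
Proof.
move=> M N g f surj_g.
have /choice[s Hs] z := surj_g (f << z >>).
have [h Hh] := fglift_linear s; exists h => D.
rewrite Hh fgliftE linear_sum -[in RHS](freeg_sumE D) linear_sum.
apply: eq_bigr => z _; rewrite linearZ_LR Hs -linearZ_LR; congr (f _).
by apply/eqP/freeg_eqP => y; rewrite coeffZ !coeffU mul1r.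
Qed.

End FreeModule.

(** * Specialization at t = 1 *)

Section Twist.
Variable R : nzRingType.

(* [A] with its scalars restricted along [s]. *)
Definition twist (s : {rmorphism R -> R}) (A : lmodType R) : Type := A.

Variable s : {rmorphism R -> R}.

Section TwistInstance.
Variable A : lmodType R.

HB.instance Definition _ := GRing.Zmodule.on (twist s A).

Definition twist_scale (a : R) (v : twist s A) : twist s A := s a *: (v : A).

Fact twist_scalerA a b v : twist_scale a (twist_scale b v) = twist_scale (a * b) v.
Proof. by rewrite /twist_scale scalerA rmorphM. Qed.

Fact twist_scale1r : left_id 1 twist_scale.
Proof. by move=> v; rewrite /twist_scale rmorph1 scale1r. Qed.

Fact twist_scalerDr : right_distributive twist_scale +%R.
Proof. by move=> a u v; rewrite /twist_scale scalerDr. Qed.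

Fact twist_scalerDl v : {morph twist_scale^~ v : a b / a + b}.
Proof. by move=> a b; rewrite /twist_scale rmorphD scalerDl. Qed.

HB.instance Definition _ := GRing.Zmodule_isLmodule.Build R (twist s A)
  twist_scalerA twist_scale1r twist_scalerDr twist_scalerDl.

End TwistInstance.

Lemma twist_linear (A B : lmodType R) (f : {linear A -> B}) :
  exists g : {linear twist s A -> twist s B}, forall a, g a = f a.
Proof.
by apply: (@linear_of R (twist s A) (twist s B) f) => a u v; rewrite linearP.
Qed.

Lemma linear_twistZ (M A : lmodType R) (f : {linear M -> twist s A}) a m :
  f (a *: m) = s a *: (f m : A) :> A.
Proof. exact: linearZ_LR. Qed.

End Twist.

Section Specialization.
Variables (R : comNzRingType) (t : R) (tau : {rmorphism R -> {poly R}}).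
(* [R] is a polynomial ring in [t] over the subring of those [b] such that
   [tau b = b%:P], and [tau] expands its elements in powers of [t]. *)
Hypothesis tau_t : tau t = 'X.
Hypothesis tauK : forall a, (tau a).[t] = a.
Hypothesis tau_coef : forall a j, tau (tau a)`_j = ((tau a)`_j)%:P.

Definition sigma : {rmorphism R -> R} := horner_eval 1 \o tau.

Lemma sigmaE a : sigma a = \sum_(j < size (tau a)) (tau a)`_j.
Proof.
rewrite /= horner_evalE horner_coef.
by apply: eq_bigr => j _; rewrite expr1n mulr1.
Qed.

Lemma sigma_t : sigma t = 1.
Proof. by rewrite /= tau_t horner_evalE hornerX. Qed.

Lemma tau_sigma a : tau (sigma a) = (sigma a)%:P.
Proof.
rewrite sigmaE rmorph_sum /= [RHS]rmorph_sum.
by apply: eq_bigr => j _; rewrite tau_coef.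
Qed.

Lemma sigma_fixed a : tau a = a%:P -> sigma a = a.
Proof. by move=> e; rewrite /= e horner_evalE hornerC. Qed.

(** The polynomial [tau a] has root 1, so ['X - 1] divides it; evaluation at [t] turns this into
    divisibility by [t - 1]. *)
Lemma sub1_dvd (a : R) : sigma a = 0 -> exists b, a = (t - 1) * b.
Proof.
rewrite /= horner_evalE => /eqP/factor_theorem[q e]; exists q.[t].
by rewrite -{1}(tauK a) e hornerM hornerXsubC mulrC.
Qed.

Lemma sub1_reg (a : R) : (t - 1) * a = 0 -> a = 0.
Proof.
move=> /(congr1 tau); rewrite rmorphM rmorphB rmorph1 tau_t rmorph0 => e.
have/monicP := monicXsubC (1 : R) => mon.
suff e0 : tau a = 0 by rewrite -(tauK a) e0 horner0.
apply: (monic_lreg (monicXsubC (1 : R))); by rewrite mulr0.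
Qed.

(** Division by [t - 1] as a function fixing 0, so that it can be applied to the coefficients of an
    element of a free module. *)
Lemma sub1_quotient :
  exists2 q : R -> R, q 0 = 0 & forall a, sigma a = 0 -> a = (t - 1) * q a.
Proof.
have /choice[q Hq] a : exists b, sigma a = 0 -> a = (t - 1) * b.
  have [/sub1_dvd[b Hb]|n] := pselect (sigma a = 0); first by exists b.
  by exists 0.
by exists q => //; apply: sub1_reg; rewrite -Hq // rmorph0.
Qed.

Lemma tau_expand n a : (size (tau a) <= n)%N ->
  a = \sum_(j < n) t ^+ j * (tau a)`_j.
Proof.
move=> le_n; rewrite -{1}(tauK a) (horner_coef_wide _ le_n).
by apply: eq_bigr => j _; rewrite mulrC.
Qed.

Lemma tau_expand_fixed n (b : nat -> R) j :
  (forall i, tau (b i) = (b i)%:P) ->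
  (tau (\sum_(i < n) t ^+ i * b i))`_j = if (j < n)%N then b j else 0.
Proof.
move=> fix_b.
have -> : tau (\sum_(i < n) t ^+ i * b i) = \poly_(i < n) b i.
  rewrite rmorph_sum poly_def; apply: eq_bigr => i _.
  by rewrite rmorphM rmorphXn tau_t fix_b mulrC mul_polyC.
by rewrite coef_poly.
Qed.

Definition sub1_regular (M : lmodType R) :=
  forall m : M, (t - 1) *: m = 0 -> m = 0.

(* [N] is the extension of scalars of [M] along [sigma]: it is the direct sum
   of the [t ^ j phi M], and [phi] has kernel [(t - 1) M]. *)
Definition specialization (M N : lmodType R) (phi : {linear M -> twist sigma N}) :=
  (forall n : N, exists r (m : nat -> M),
     n = \sum_(j < r) t ^+ j *: (phi (m j) : N)) /\
  (forall r (m : nat -> M), \sum_(j < r) t ^+ j *: (phi (m j) : N) = 0 ->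
     forall j, (j < r)%N -> exists u, m j = (t - 1) *: u).

Lemma twist_sub1 (M A : lmodType R) (h : {linear M -> twist sigma A}) u :
  h ((t - 1) *: u) = 0.
Proof. by rewrite (linear_twistZ h) rmorphB rmorph1 sigma_t subrr scale0r. Qed.

(** The rule sending each sum of [t ^+ j *: phi (m j)] to the sum of [t ^+ j *: h (m j)] is a linear
    relation. It is single-valued because an expansion of 0 has all [m j] in (t - 1) M, which [h]
    kills. *)
Lemma specialization_universal (M N A : lmodType R)
    (phi : {linear M -> twist sigma N}) (h : {linear M -> twist sigma A}) :
  specialization phi -> exists k : {linear N -> A}, forall m, k (phi m) = h m.
Proof.
move=> [gen indep].
pose rel (n : N) (y : A) := exists r (m : nat -> M),
  n = \sum_(j < r) t ^+ j *: (phi (m j) : N) /\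
  y = \sum_(j < r) t ^+ j *: (h (m j) : A).
have pad (B : lmodType R) (f : {linear M -> twist sigma B}) r r' (m : nat -> M) :
    \sum_(j < r) t ^+ j *: (f (m j) : B) =
    \sum_(j < r + r') t ^+ j *: (f (if (j < r)%N then m j else 0) : B).
  rewrite (big_ord_widen _ (fun j => t ^+ j *: (f (m j) : B)) (leq_addr r' r)).
  rewrite big_mkcond; apply: eq_bigr => j _.
  by case: ifP => // _; rewrite linear0 scaler0.
have relD n y n' y' : rel n y -> rel n' y' -> rel (n + n') (y + y').
  move=> [r [m [-> ->]]] [r' [m' [-> ->]]].
  exists (r + r')%N, (fun j => (if (j < r)%N then m j else 0) +
                               (if (j < r')%N then m' j else 0)).
  rewrite (pad _ phi r r') (pad _ h r r') (pad _ phi r' r) (pad _ h r' r).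
  by rewrite [(r' + r)%N]addnC -!big_split; split; apply: eq_bigr => j _;
     rewrite linearD scalerDr.
have rel00 : rel 0 0 by exists 0%N, (fun=> 0); rewrite !big_ord0.
have relt n y : rel n y -> rel (t *: n) (t *: y).
  move=> [r [m [-> ->]]].
  exists r.+1, (fun j => if j is j'.+1 then m j' else 0).
  by split; rewrite big_ord_recl linear0 scaler0 add0r scaler_sumr;
     apply: eq_bigr => j _; rewrite scalerA -exprS.
(* A scalar free of [t] is fixed by [sigma], so it can be moved inside [phi] and [h]. Together with
   multiplication by [t] this reaches all scalars. *)
have relb b n y : tau b = b%:P -> rel n y -> rel (b *: n) (b *: y).
  move=> fix_b [r [m [-> ->]]]; exists r, (fun j => b *: m j).
  by split; rewrite scaler_sumr; apply: eq_bigr => j _;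
     rewrite linear_twistZ (sigma_fixed fix_b) !scalerA mulrC.
have relZ a n y : rel n y -> rel (a *: n) (a *: y).
  move=> ny; rewrite (tau_expand (leqnn (size (tau a)))) !scaler_suml.
  elim/big_rec2: _ => // j y1 n1 _ IH; apply: relD => //.
  rewrite -!scalerA; have := relb _ _ _ (tau_coef a j) ny.
  move: (_ *: n) (_ *: y) => n2 y2 r2.
  elim: (j : nat) => [|i IHi]; first by rewrite expr0 !scale1r.
  by rewrite !exprS -!scalerA; apply: relt.
have rel_phi m : rel (phi m) (h m).
  by exists 1%N, (fun=> m); rewrite !big_ord1 expr0 !scale1r.
have rel0 y : rel 0 y -> y = 0.
  move=> [r [m [/esym/indep m0 ->]]]; rewrite big1 // => j _.
  by have [u ->] := m0 j (ltn_ord j); rewrite twist_sub1 scaler0.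
have [n|k Hk] := linear_of_rel relD relZ _ rel0.
  have [r [m ->]] := gen n.
  by exists (\sum_(j < r) t ^+ j *: (h (m j) : A)), r, m.
(* Both [k (phi m)] and [h m] are related to [phi m], so their difference is related to 0. *)
exists k => m; apply/eqP; rewrite -subr_eq0; apply/eqP/rel0.
rewrite -[X in rel X](subrr (phi m : N)) -!scaleN1r.
by apply: relD => //; apply: relZ.
Qed.

Lemma specialization_projective (M N : lmodType R)
    (phi : {linear M -> twist sigma N}) :
  specialization phi -> projective M -> projective N.
Proof.
move=> spec projM X Y g f surj_g.
have [g' Hg'] := twist_linear sigma g.
have [f' Hf'] := twist_linear sigma f.
have [y|h Hh] := projM (twist sigma X) (twist sigma Y) g' (f' \o phi).
  by have [x <-] := surj_g y; exists x; rewrite Hg'.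
have [k Hk] := specialization_universal h spec.
exists k => n; have [r [m ->]] := spec.1 n.
rewrite !linear_sum; apply: eq_bigr => j _.
by rewrite !linearZ_LR Hk -Hg' Hh /= Hf'.
Qed.

Section FreeSpecialization.
Variable X : choiceType.
Let F : lmodType R := {freeg X / R}.

Lemma coeff_fgmap (f : R -> R) (D : F) z : f 0 = 0 ->
  coeff z (fgmap predT f D) = f (coeff z D).
Proof. exact: fgmap_f0_coeffE. Qed.

Lemma coeff_sumZ r (D : nat -> F) z :
  coeff z (\sum_(j < r) t ^+ j *: D j) = \sum_(j < r) t ^+ j * coeff z (D j).
Proof. by rewrite raddf_sum; apply: eq_bigr => j _; rewrite /= coeffZ. Qed.

Lemma free_regular : sub1_regular F.
Proof.
move=> D tD; apply/eqP/freeg_eqP => z; rewrite coeff0.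
by apply: sub1_reg; rewrite -coeffZ tD coeff0.
Qed.

(** Applying [sigma] to coefficients exhibits a free module as its own extension of scalars;
    [free_expand] and [free_independent] give the two halves of this. *)
Lemma freeg_sigma :
  exists s : {linear F -> twist sigma F},
    forall D z, coeff z (s D : F) = sigma (coeff z D).
Proof.
have [a u v|s Hs] := @linear_of R F (twist sigma F) (fgmap predT sigma).
  rewrite -[RHS]/(sigma a *: (fgmap predT sigma u : F) + fgmap predT sigma v).
  apply/eqP/freeg_eqP => z; rewrite coeff_fgmap ?rmorph0 //.
  by rewrite !coeffD !coeffZ !coeff_fgmap ?rmorph0 // rmorphD rmorphM.
by exists s => D z; rewrite Hs coeff_fgmap // rmorph0.
Qed.

Lemma free_expand (s : {linear F -> twist sigma F}) :
  (forall D z, coeff z (s D : F) = sigma (coeff z D)) ->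
  forall D : F, exists r (m : nat -> F),
    D = \sum_(j < r) t ^+ j *: m j /\ forall j, s (m j) = m j.
Proof.
move=> Hs D; pose c j (a : R) := (tau a)`_j.
have c0 j : c j 0 = 0 by rewrite /c rmorph0 coef0.
(* One length that serves for the expansions of all coefficients; outside the support they
   vanish. *)
exists (\max_(z <- dom D) size (tau (coeff z D))), (fun j => fgmap predT (c j) D).
split=> [|j]; apply/eqP/freeg_eqP => z; last first.
  by rewrite Hs coeff_fgmap // sigma_fixed // tau_coef.
rewrite (coeff_sumZ _ (fun j => fgmap predT (c j) D)).
under [RHS]eq_bigr => j _ do rewrite (coeff_fgmap _ _ (c0 j)).
have [zD|/coeff_outdom->] := boolP (z \in dom D); last first.
  by rewrite big1 // => j _; rewrite c0 mulr0.
by apply: tau_expand; exact: (leq_bigmax_seq z (P := xpredT)).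
Qed.

Lemma free_independent (s : {linear F -> twist sigma F}) :
  (forall D z, coeff z (s D : F) = sigma (coeff z D)) ->
  forall r (m : nat -> F), \sum_(j < r) t ^+ j *: (s (m j) : F) = 0 ->
     forall j, (j < r)%N -> exists u, m j = (t - 1) *: u.
Proof.
move=> Hs r m m0 j lt_jr; have [q q0 Hq] := sub1_quotient.
exists (fgmap predT q (m j)); apply/eqP/freeg_eqP => z.
rewrite coeffZ coeff_fgmap //; apply: Hq.
have := coeff_sumZ r (fun j => s (m j) : F) z; rewrite m0 coeff0.
under eq_bigr do rewrite Hs.
move=> /(congr1 (fun a => (tau a)`_j)).
rewrite rmorph0 coef0 (@tau_expand_fixed _ (fun i => sigma (coeff z (m i)))) => [|i].
  by rewrite lt_jr.
exact: tau_sigma.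
Qed.

End FreeSpecialization.

(** The free module [F] on the elements of [M] covers [M] by [p] and [N] by [p'], and [sigma] on
    coefficients links the two covers. The induced map [psi] makes the kernel [K'] a specialization
    of [K], and [K] is again regular, as a submodule of [F]. *)
Lemma specialization_pdle d (M N : lmodType R) (phi : {linear M -> twist sigma N}) :
  sub1_regular M -> specialization phi -> pdle d M -> pdle d N.
Proof.
elim: d M N phi => [|d IHd] M N phi regM spec.
  exact: specialization_projective spec.
move=> [P [K0 [i0 [p0 [projP ip0 K0d]]]]].
pose F : lmodType R := {freeg M / R}.
have projF : projective F by exact: freeg_projective.
have [p Hp] := fglift_linear (fun m : M => m).
have [p' Hp'] := fglift_linear (phi : M -> N).
have [s Hs] := freeg_sigma M.
have p_gen m : p << m >> = m by rewrite Hp liftU scale1r.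
have p'_gen m : p' << m >> = phi m by rewrite Hp' liftU scale1r.
have p's D : p' (s D) = phi (p D).
  rewrite Hp fgliftE linear_sum -{1}[D]freeg_sumE.
  rewrite linear_sum -[LHS]/(p' (\sum_(z <- dom D) (s << coeff z D *g z >> : F))).
  rewrite linear_sum; apply: eq_bigr => z _.
  rewrite linear_twistZ -p'_gen -linearZ_LR; congr (p' _).
  by apply/eqP/freeg_eqP => y; rewrite Hs coeffZ !coeffU rmorphM mul1r rmorph_nat.
have surj_p m : exists D, p D = m by exists << m >>.
have surj_p' n : exists D, p' D = n.
  have [r [m ->]] := spec.1 n.
  exists (\sum_(j < r) t ^+ j *: (<< m j >> : F)); rewrite linear_sum.
  by apply: eq_bigr => j _; rewrite linearZ_LR p'_gen.
have [K [i [inj_i exi]]] := kernel_exists p.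
have [K' [i' [inj_i' exi']]] := kernel_exists p'.
have pi k : p (i k) = 0 by apply/exi; exists k.
have p'i k : p' (i' k) = 0 by apply/exi'; exists k.
(* The given projective cover is traded for the free one. *)
have Kd : pdle d K by apply: schanuel ip0 _ projP projF K0d; split; eassumption.
have [ti Hti] := twist_linear sigma i'.
have [|u|psi Hpsi] := @lift_to_kernel R (twist sigma K') (twist sigma F) K ti (s \o i).
- by move=> u v; rewrite !Hti => /inj_i'.
- have /exi'[k' Hk'] : p' (s (i u)) = 0 by rewrite p's pi linear0.
  by exists k'; rewrite Hti Hk'.
have i'psi k : i' (psi k) = s (i k) by rewrite -Hti Hpsi.
exists F, K', i', p'; split=> //.
apply: (IHd K K' psi) Kd => [k tk|].
  apply: inj_i; rewrite linear0; apply: free_regular.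
  by rewrite -linearZ_LR tk linear0.
split=> [n|r m m0 j lt_jr].
  (* The coefficients [D j] of an element of [K'] need not lie in [K], but [p (D j)] is a multiple
     of [t - 1]. Subtracting a suitable [(t - 1) *: v] moves [D j] into [K] without changing its
     image under [s]. *)
  have [r [D [nD sD]]] := free_expand Hs (i' n).
  have D0 : \sum_(j < r) t ^+ j *: (phi (p (D j)) : N) = 0.
    apply: etrans (p'i n); rewrite nD linear_sum; apply: eq_bigr => j _.
    by rewrite linearZ_LR -p's sD.
  have Du := spec.2 r (fun j => p (D j)) D0.
  have /choice[m Hm] j : exists k, (j < r)%N -> s (i k) = D j.
    have [lt_jr|] := boolP (j < r)%N; last by exists 0.
    have [u Hu] := Du j lt_jr; have [v Hv] := surj_p u.
    have /exi[k Hk] : p (D j - (t - 1) *: v) = 0.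
      by rewrite linearB linearZ_LR Hv -Hu subrr.
    by exists k => _; rewrite Hk linearB twist_sub1 subr0 sD.
  exists r, m; apply: inj_i'; rewrite nD linear_sum; apply: eq_bigr => j _.
  by rewrite linearZ_LR i'psi Hm.
have sm0 : \sum_(j < r) t ^+ j *: (s (i (m j)) : F) = 0.
  apply: etrans (etrans (congr1 i' m0) (linear0 i')).
  rewrite linear_sum; apply: eq_bigr => l _.
  by rewrite linearZ_LR i'psi.
have [u Hu] := free_independent (m := fun j => i (m j)) Hs sm0 lt_jr.
(* Regularity of [M] enters here: (t - 1) u lies in the kernel of [p], hence so does [u]. *)
have /exi[k Hk] : p u = 0 by apply: regM; rewrite -linearZ_LR -Hu.
by exists k; apply: inj_i; rewrite linearZ_LR Hk.
Qed.

(** [J] is (I, t), and the first map is multiplication by [t]. *)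
Lemma ses_colon (I J : ideal R) :
  (forall f, f \in J <-> exists g, f - t * g \in I) ->
  exists (i : {linear quotmod (colon I t) -> quotmod I})
    (p : {linear quotmod I -> quotmod J}), ses i p.
Proof.
move=> memJ.
have IJ f : f \in I -> f \in J by move=> If; apply/memJ; exists 0; rewrite mulr0 subr0.
have [pA [pA_surj pA0]] := quotmod_proj (colon I t).
have [pB [pB_surj pB0]] := quotmod_proj I.
have [pC [pC_surj pC0]] := quotmod_proj J.
have [a u v|mt Hmt] := @linear_of R R^o (quotmod I) (fun f => pB (t * f)).
  by rewrite mulrDr -[a *: u]/(a * u) mulrCA -linearP.
have [v|i Hi] := linear_factor (g := mt) pA_surj.
  by move=> /pA0 Iv; rewrite Hmt; apply/pB0.
have [v|p Hp] := linear_factor (g := pC) pB_surj.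
  by move=> /pB0/IJ/pC0.
exists i, p; split=> [x y|c|b].
- have [u <-] := pA_surj x; have [v <-] := pA_surj y.
  rewrite !Hi !Hmt => /eqP; rewrite -subr_eq0 -linearB -mulrBr => /eqP/pB0 Iuv.
  by apply/eqP; rewrite -subr_eq0 -linearB; apply/eqP/pA0.
- by have [u <-] := pC_surj c; exists (pB u); rewrite Hp.
- have [f <-] := pB_surj b; rewrite Hp; split=> [/pC0/memJ[g Ig]|[x]].
    exists (pA g); rewrite Hi Hmt; apply/esym/eqP.
    by rewrite -subr_eq0 -linearB; apply/eqP/pB0.
  have [g <-] := pA_surj x; rewrite Hi Hmt => /eqP.
  rewrite eq_sym -subr_eq0 -linearB => /eqP/pB0 Ig.
  by apply/pC0/memJ; exists g.
Qed.

(** The hypotheses on expansions in [t] record that [I] is generated in degrees 0 and 1 in [t]. They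
    make S/I regular for [t - 1], and make the map induced by [sigma] from S/I to S/(I:t) a
    specialization. *)
Lemma pdle_colon (I : ideal R) :
  (forall f, f \in I -> (tau f)`_0 \in I) ->
  (forall f j, f \in I -> t * (tau f)`_j \in I) ->
  forall d, pdle d (quotmod I) -> pdle d (quotmod (colon I t)).
Proof.
move=> I0 It d.
have IZ a f : f \in I -> a * f \in I by apply: (rpredZ (s := I)).
have ID f g : f \in I -> g \in I -> f + g \in I by apply: (@rpredD _ I).
have IB f g : f \in I -> g \in I -> f - g \in I
  by move=> If Ig; rewrite -[- g]mulN1r; apply: ID => //; apply: IZ.
have Isum n (F : 'I_n -> R) : (forall j, F j \in I) -> \sum_j F j \in I.
  by move=> IF; apply: (@rpred_sum _ I).
have sigI f : f \in I -> sigma f \in colon I t.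
  move=> If; rewrite -[_ \in _]/(t * sigma f \in I) sigmaE mulr_sumr.
  by apply: Isum => j; apply: It.
have [pA [pA_surj pA0]] := quotmod_proj (colon I t).
have [pB [pB_surj pB0]] := quotmod_proj I.
have [a u v|g Hg] := @linear_of R R^o (twist sigma (quotmod (colon I t)))
    (fun f => pA (sigma f)).
  by rewrite rmorphD rmorphM linearD -[sigma a * _]/(sigma a *: _) linearZ_LR.
have [v|phi Hphi] := linear_factor (g := g) pB_surj.
  by move=> /pB0 Iv; rewrite Hg; apply/pA0/sigI.
apply: (@specialization_pdle d _ _ phi).
  move=> m; have [f <-] := pB_surj m; rewrite -linearZ_LR => /pB0 If.
  apply/pB0; rewrite (tau_expand (leqnn (size (tau f)))).
  (* Writing c_j for the coefficients of [f], those of (t - 1) f are - c_0 and c_j - c_(j+1), so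
     membership of t c_j in [I] propagates upwards from c_0. *)
  have t1f : tau ((t - 1) * f) = 'X * tau f - tau f.
    by rewrite rmorphM rmorphB rmorph1 tau_t mulrBl mul1r.
  have If0 : (tau f)`_0 \in I.
    by have := IZ (-1) _ (I0 _ If); rewrite t1f coefB coefXM sub0r mulN1r opprK.
  have Itf j : t * (tau f)`_j \in I.
    elim: j => [|j IHj]; first exact: IZ.
    have := IB _ _ IHj (It _ j.+1 If).
    by rewrite t1f coefB coefXM /= mulrBr opprB addrCA subrr addr0.
  apply: Isum => -[[|j] _] /=; first by rewrite mul1r.
  by rewrite exprSr -mulrA; apply: IZ.
split=> [n|r m m0 j lt_jr].
  have [f <-] := pA_surj n.
  exists (size (tau f)), (fun j => pB (tau f)`_j).
  rewrite {1}(tau_expand (leqnn (size (tau f)))) linear_sum; apply: eq_bigr => j _.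
  by rewrite Hphi Hg sigma_fixed ?tau_coef // -linearZ_LR.
have /choice[f Hf] j0 := pB_surj (m j0).
have : t * (\sum_(j < r) t ^+ j * sigma (f j)) \in I.
  apply/(pA0 (\sum_(j < r) t ^+ j * sigma (f j))).
  apply: etrans m0; rewrite linear_sum; apply: eq_bigr => l _.
  rewrite -Hf Hphi Hg; exact: linearZ_LR.
(* The extra factor [t] shifts degrees: the coefficient in degree [j.+1] is [sigma (f j)]. *)
move=> /(It _ j.+1).
rewrite rmorphM tau_t coefXM /=.
rewrite (@tau_expand_fixed _ (fun l => sigma (f l))) => [|l]; last first.
  exact: tau_sigma.
rewrite lt_jr => Itf.
(* Modulo [I], [f j] equals [f j - t * sigma (f j)], which [sigma] sends to 0. *)
have [b Hb] : exists b, f j - t * sigma (f j) = (t - 1) * b.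
  apply: sub1_dvd; rewrite rmorphB rmorphM sigma_t mul1r.
  by rewrite (sigma_fixed (tau_sigma _)) subrr.
exists (pB b); rewrite -Hf; apply: etrans (linearZ_LR pB (t - 1) b).
by rewrite -[(t - 1) *: _]Hb linearB ((pB0 (t * sigma (f j))).2 Itf) subr0.
Qed.

End Specialization.

(** * Monomial ideals *)

Section Ideals.
Variable R : comNzRingType.
Implicit Types (I J : ideal R) (A : R -> Prop) (s : seq R).

Lemma mem_idgen A f : A f -> f \in idgen A.
Proof.
move=> Af; apply/asboolP; exists 1%N, (fun=> 1), (fun=> f).
by rewrite big_ord1 mul1r.
Qed.

Lemma idgen_sub A J : (forall f, A f -> f \in J) -> {subset idgen A <= J}.
Proof.
move=> AJ f /asboolP[m [a [g [Ag ->]]]]; apply: (@rpred_sum _ J) => i _.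
exact/(rpredZ (s := J))/AJ.
Qed.

Lemma mem_adjoin I s f : f \in I \/ f \in s -> f \in adjoin I s.
Proof. exact: mem_idgen. Qed.

Lemma adjoin_nil I : adjoin I [::] =i I.
Proof.
move=> f; apply/idP/idP => [|If]; last by apply: mem_adjoin; left.
by apply: idgen_sub => g [].
Qed.

(** Adjoining one more element, put in the form that [ses_colon] expects. *)
Lemma adjoin_rcons I s a f :
  f \in adjoin I (rcons s a) <-> exists g, f - a * g \in adjoin I s.
Proof.
split=> [/asboolP[m [b [h [Ah ->]]]]|[g Ig]].
  have /choice[g Hg] i : exists g, b i * h i - a * g \in adjoin I s.
    have [Ih|] := Ah i.
      exists 0; rewrite mulr0 subr0; apply: (rpredZ (s := adjoin I s)).
      by apply: mem_adjoin; left.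
    rewrite mem_rcons inE => /orP[/eqP->|sh].
      by exists (b i); rewrite mulrC subrr rpred0.
    exists 0; rewrite mulr0 subr0; apply: (rpredZ (s := adjoin I s)).
    by apply: mem_adjoin; right.
  exists (\sum_i g i); rewrite mulr_sumr -sumrB.
  by apply: (@rpred_sum _ (adjoin I s)) => i _; apply: Hg.
rewrite -(subrK (a * g) f); apply: (@rpredD _ (adjoin I (rcons s a))).
  apply: idgen_sub Ig => h [Ih|sh]; apply: mem_adjoin; [by left | right].
  by rewrite mem_rcons inE sh orbT.
rewrite mulrC; apply: (rpredZ (s := adjoin I (rcons s a))).
by apply: mem_adjoin; right; rewrite mem_rcons mem_head.
Qed.

(** Ideals with the same elements may still have different quotient types, so the comparison goes
    through an isomorphism. *)
Lemma pd_quotmod_eq I J : I =i J -> pd (quotmod I) = pd (quotmod J).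
Proof.
have sub d (I1 I2 : ideal R) :
    I1 =i I2 -> pdle d (quotmod I1) -> pdle d (quotmod I2).
  move=> eqI; have [p [p_surj p0]] := quotmod_proj I1.
  have [q [q_surj q0]] := quotmod_proj I2.
  have [v /p0|f Hf] := linear_factor (g := q) p_surj.
    by rewrite eqI => /q0.
  apply: (pdle_iso (f := f)) => [u v|w].
    have [a <-] := p_surj u; have [b <-] := p_surj v; rewrite !Hf => /eqP.
    rewrite -subr_eq0 -linearB => /eqP/q0; rewrite -eqI => /p0/eqP.
    by rewrite linearB subr_eq0 => /eqP.
  by have [a <-] := q_surj w; exists (p a).
by move=> eqI; apply: pd_eq => d; split; apply: sub.
Qed.

End Ideals.

(** * Splitting off one variable *)

Section SplitVariable.
Variables (k : fieldType) (n : nat) (v : 'I_n).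
Local Notation S := {mpoly k[n]}.

(** The expansion in powers of ['X_v]. Coefficients stay in [S] itself, as elements free of ['X_v],
    which avoids renumbering the other variables. *)
Definition split_var : {rmorphism S -> {poly S}} :=
  mmap (polyC \o @mpolyC n k) (fun u => if u == v then 'X else ('X_u)%:P).

Definition other_vars (m : 'X_{1..n}) : S := \prod_(u < n | u != v) 'X_u ^+ m u.

Lemma split_varC c : split_var c%:MP = (c%:MP)%:P.
Proof. by rewrite /= mmapC. Qed.

Lemma split_varX u : split_var 'X_u = if u == v then 'X else ('X_u)%:P.
Proof. by rewrite /= mmapX mmap1U. Qed.

Lemma split_var_other m : split_var (other_vars m) = (other_vars m)%:P.
Proof.
rewrite rmorph_prod /= [RHS]rmorph_prod; apply: eq_bigr => u /negbTE uv.
by rewrite !rmorphXn split_varX uv.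
Qed.

Lemma mpolyX_split m : 'X_[m] = other_vars m * 'X_v ^+ m v :> S.
Proof. by rewrite mpolyXE_id (bigD1 v) //= mulrC. Qed.

Lemma split_var_monomial m : split_var 'X_[m] = (other_vars m)%:P * 'X ^+ m v.
Proof.
by rewrite mpolyX_split rmorphM rmorphXn split_varX eqxx split_var_other.
Qed.

Lemma split_varE a :
  split_var a = \sum_(m <- msupp a) (a@_m *: other_vars m)%:P * 'X ^+ m v.
Proof.
rewrite [in LHS](mpolyE a); apply: (etrans (rmorph_sum split_var _ _ _)).
apply: eq_bigr => m _; rewrite -mul_mpolyC.
apply: (etrans (rmorphM split_var _ _)).
by rewrite split_varC split_var_monomial mulrA -polyCM mul_mpolyC.
Qed.

Lemma split_varK a : (split_var a).['X_v] = a.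
Proof.
rewrite split_varE horner_sum [RHS]mpolyE; apply: eq_bigr => m _.
by rewrite hornerM hornerC hornerXn (mpolyX_split m) scalerAl.
Qed.

Lemma split_var_coef a j : split_var (split_var a)`_j = ((split_var a)`_j)%:P.
Proof.
have -> : (split_var a)`_j =
    \sum_(m <- msupp a) (a@_m)%:MP * (other_vars m * (j == m v)%:R).
  rewrite split_varE coef_sum; apply: eq_bigr => m _.
  by rewrite coefCM coefXn -mul_mpolyC mulrA.
apply: (etrans (rmorph_sum split_var _ _ _)); rewrite [RHS]rmorph_sum.
apply: eq_bigr => m _; apply: (etrans (rmorphM split_var _ _)).
rewrite split_varC [split_var _](rmorphM split_var) split_var_other.
rewrite [split_var _](rmorph_nat split_var).
by apply: etrans (esym (polyCM _ _)); rewrite polyCM rmorph_nat.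
Qed.

Lemma squarefree_split (I : ideal S) : squarefree_monomial_ideal I ->
  (forall f, f \in I -> (split_var f)`_0 \in I) /\
  (forall f j, f \in I -> 'X_v * (split_var f)`_j \in I).
Proof.
move=> [G sqG IG].
have IZ a f : f \in I -> a * f \in I by apply: (rpredZ (s := I)).
have IX m : G m -> 'X_[m] \in I.
  by move=> Gm; rewrite IG; apply: mem_idgen; exists m.
suff H f j : f \in I -> (split_var f)`_0 \in I /\ 'X_v * (split_var f)`_j \in I.
  by split=> [f /(H f 0%N)[]|f j /(H f j)[]].
rewrite IG => /asboolP[r [a [g [Gg ->]]]].
rewrite !rmorph_sum !coef_sum mulr_sumr.
suff Hl l : (split_var (a l * g l))`_0 \in I /\
            'X_v * (split_var (a l * g l))`_j \in I.
  by split; apply: (@rpred_sum _ I) => l _; case: (Hl l).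
have [m Gm ->] := Gg l; have Im := IX m Gm.
have splitE j0 : (split_var (a l * 'X_[m]))`_j0 =
    other_vars m * (split_var (a l) * 'X ^+ m v)`_j0.
  rewrite [split_var _](rmorphM split_var) split_var_monomial.
  by rewrite mulrCA coefCM.
have := sqG m Gm v; move: Im; rewrite !splitE (mpolyX_split m).
move: (split_var (a l)) (other_vars m) => p y.
(* If ['X_v] does not occur in the generator, every coefficient is a multiple of the generator. If
   it occurs once, the constant coefficient is 0 and the others become multiples of the generator
   after multiplication by ['X_v]. *)
case: (m v) => [|[|//]] Im _.
  rewrite !expr0 !mulr1 in Im *; split; first by rewrite mulrC; apply: IZ.
  by rewrite mulrCA mulrC; apply: IZ.
rewrite !expr1 in Im *; rewrite !coefMX /= mulr0; split; first exact: (@rpred0 _ I).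
case: (j == 0)%N; first by rewrite !mulr0; exact: (@rpred0 _ I).
by rewrite mulrCA mulrA mulrC; apply: IZ.
Qed.

Lemma pd_colon_variable (I J : ideal S) : squarefree_monomial_ideal I ->
  (forall f, f \in J <-> exists g, f - 'X_v * g \in I) ->
  pd (quotmod I) = pd (quotmod (colon I 'X_v)) \/ pd (quotmod I) = pd (quotmod J).
Proof.
move=> /squarefree_split[I0 IX] memJ.
have [i [p ip]] := ses_colon memJ; apply: pd_ses ip _ => d.
apply: (pdle_colon (tau := split_var)) => //.
- by rewrite split_varX eqxx.
- exact: split_varK.
- exact: split_var_coef.
Qed.

End SplitVariable.

Lemma squarefree_adjoin (k : fieldType) (n : nat) (I : ideal {mpoly k[n]})
    (s : seq 'I_n) :
  squarefree_monomial_ideal I ->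
  squarefree_monomial_ideal (adjoin I [seq 'X_v | v <- s]).
Proof.
move=> [G sqG IG].
exists (fun m => G m \/ exists2 v, v \in s & m = U_(v)%MM)
  => [m [/sqG//|[v _ ->]] u|f].
  by rewrite mnm1E leq_b1.
apply/idP/idP; apply: idgen_sub => {}f.
  move=> [|/mapP[v sv ->]]; last first.
    by apply: mem_idgen; exists U_(v)%MM => //; right; exists v.
  rewrite IG; apply: idgen_sub => g [m Gm ->].
  by apply: mem_idgen; exists m => //; left.
move=> [m [Gm|[v sv ->]] ->]; apply: mem_adjoin; last by right; apply: map_f.
by left; rewrite IG; apply: mem_idgen; exists m.
Qed.

Theorem lemma5p1 (k : fieldType) (n : nat) (I : ideal {mpoly k[n]})
    (hI : squarefree_monomial_ideal I)
    (L : {set 'I_n}) (i : nat) (x : i.-tuple 'I_n)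
    (x_uniq : uniq x) (xL : L = [set v in x]) :
  (exists j : 'I_i,
     pd (quotmod I) =
     pd (quotmod (colon (adjoin I [seq 'X_v | v <- take j x]) 'X_(tnth x j)))) \/
  pd (quotmod I) = pd (quotmod (adjoin I [seq 'X_v | v <- x])).
Proof.
have [|no_j] := pselect (exists j : 'I_i, pd (quotmod I) =
  pd (quotmod (colon (adjoin I [seq 'X_v | v <- take j x]) 'X_(tnth x j)))).
  by left.
right.
(* When every colon alternative fails, [pd] stays the same as the variables are adjoined one by one.
   Indices start at 0, so [take j x] lists the variables before [tnth x j]. *)
suff H j : (j <= i)%N ->
    pd (quotmod I) = pd (quotmod (adjoin I [seq 'X_v | v <- take j x])).
  by have := H i (leqnn i); rewrite -{1}(size_tuple x) take_size.
elim: j => [_|j IHj lt_ji].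
  by rewrite take0 /=; apply: pd_quotmod_eq => f; rewrite adjoin_nil.
pose j' := Ordinal lt_ji; rewrite (IHj (ltnW lt_ji)).
have [||] := @pd_colon_variable k n (tnth x j') (adjoin I [seq 'X_v | v <- take j x])
  (adjoin I [seq 'X_v | v <- take j.+1 x]) (squarefree_adjoin _ hI) => [f||//].
  rewrite (take_nth (tnth x j')) ?size_tuple // map_rcons.
  rewrite -[nth _ _ _](tnth_nth _ x j').
  exact: adjoin_rcons.
by move=> e; case: no_j; exists j'; rewrite (IHj (ltnW lt_ji)).
Qed.
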